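(* Let $m,N\ge 1$ be integers, $\mathbb{T}=\{1,\dots,m\}$, $\mathcal{N}=\{1,\dots,N\}$. Consider a group of $N$ loads with heterogeneous parameters $\Omega^i=\{a^i,d^i,p^i,\underline{E}^i,\bar{E}^i\}$, $i\in\mathcal{N}$, where $a^i<d^i$ are in $\mathbb{T}$, $\mathbb{A}^i=\{a^i,a^i+1,\dots,d^i\}$, $p^i>0$ and $\underline{E}^i<\bar{E}^i$ are real numbers. Let $\mathcal{P}\subset\mathbb{R}^m$ be the set of adequate generation profiles. Then $\mathcal{P}$ consists exactly of those $u=[u_1,\dots,u_m]^T\in\mathbb{R}^m$ which satisfy $$\min\left\{\sum_{i\in\alpha}\bar{E}^i-\sum_{t\in\beta}u_t,\ \sum_{t\in\beta^c}u_t-\sum_{i\in\alpha^c}\underline{E}^i\right\}\ \geq\ -\sum_{i\in\alpha^c}\left|\beta\cap\mathbb{A}^i\right|p^i$$ for all subsets $\alpha\subset\mathcal{N}$ and $\beta\subset\mathbb{T}$ (including empty and full subsets), where $\alpha^c=\mathcal{N}\setminus\alpha$ and $\beta^c=\mathbb{T}\setminus\beta$.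
   Context: The $i$-th load (a plug-in electric vehicle or other deferrable load) may only be charged during the time slots in $\mathbb{A}^i=\{a^i,\dots,d^i\}\subset\mathbb{T}$, at a power in $[0,p^i]$ in each slot (slots have unit length), and must receive total energy in $[\underline{E}^i,\bar{E}^i]$. Its set of admissible power profiles is $$\mathcal{P}^i:=\Big\{u^i\in\mathbb{R}^m:\ u^i_t\in[0,p^i]\ \forall t\in\mathbb{A}^i,\ \ u^i_t=0\ \forall t\in\mathbb{T}\setminus\mathbb{A}^i,\ \ \sum_{t=1}^m u^i_t\in[\underline{E}^i,\bar{E}^i]\Big\}.$$ A generation profile $u\in\mathbb{R}^m$ is called adequate if there is a decomposition $u=\sum_{i=1}^N u^i$ with $u^i\in\mathcal{P}^i$ for every $i\in\mathcal{N}$. The set $\mathcal{P}$ of all adequate generation profiles (the aggregate flexibility) is thus the Minkowski sum of $\mathcal{P}^1,\dots,\mathcal{P}^N$. Sums over empty index sets are zero. *)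

(* Defs.v *)
From HB Require Import structures.
From mathcomp Require Import all_boot all_order all_algebra.
From mathcomp Require Import classical_sets reals.

Set Implicit Arguments.
Unset Strict Implicit.
Unset Printing Implicit Defensive.

Import Order.TTheory GRing.Theory Num.Theory.
Local Open Scope classical_set_scope.
Local Open Scope ring_scope.

(* The time slots 1, ..., m are represented by the ordinals 0, ..., m - 1 of
   type 'I_m, and likewise the loads 1, ..., N by 'I_N. *)

Record load (R : realType) (m : nat) := Load {
  arrival : 'I_m;
  departure : 'I_m;
  rate : R;
  Emin : R;
  Emax : R
}.

Definition slots (R : realType) (m : nat) (L : load R m) : {set 'I_m} :=
  [set t : 'I_m | (arrival L <= t <= departure L)%N].

Definition admissible (R : realType) (m : nat) (L : load R m) :
    set 'cV[R]_m :=
  [set u : 'cV[R]_m |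
    [/\ forall t, t \in slots L -> 0 <= u t ord0 <= rate L,
        forall t, t \notin slots L -> u t ord0 = 0
      & Emin L <= \sum_(t < m) u t ord0 <= Emax L]].

Definition adequate (R : realType) (m N : nat) (Omega : 'I_N -> load R m) :
    set 'cV[R]_m :=
  [set u : 'cV[R]_m |
    exists2 v : 'I_N -> 'cV[R]_m,
      forall i, admissible (Omega i) (v i) & u = \sum_(i < N) v i].

(* Main.v *)
Require Import Defs.
From HB Require Import structures.
From mathcomp Require Import all_boot all_order all_algebra.
From mathcomp Require Import classical_sets reals.
From mathcomp Require Import lra.

Set Implicit Arguments.
Unset Strict Implicit.
Unset Printing Implicit Defensive.

Import Order.TTheory GRing.Theory Num.Theory.
Local Open Scope classical_set_scope.
Local Open Scope ring_scope.

(** A decomposition of [u] into admissible profiles is a flow.  Let a hub send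
    to each load [i] an energy between [Emin] and [Emax], let load [i] pass at
    most its rate on to each slot of its charging window, and let slot [t]
    return exactly [u t] to the hub.  The decompositions of [u] are the
    circulations of this network ([adequate_circulation]), so adequacy is
    decided by Hoffman's theorem: a circulation between edge bounds [l <= h]
    exists if and only if, for each set [S] of vertices, the lower bounds of the
    edges entering [S] do not exceed in total the upper bounds of the edges
    leaving [S] ([hoffman_circulation]).  A set of vertices amounts to a choice
    of [alpha], of [beta] and of the side of the hub; the cut inequality is the
    first entry of the minimum when the hub lies in [S] and the second entry
    when it does not ([cut_side_le]).

    The sufficiency half of Hoffman's theorem goes by pinning the edges one
    after the other, that is, replacing [l a] and [h a] by a common value, while
    keeping every cut surplus nonnegative ([pin_feasible]).  The cuts that
    [a] leaves bound this value from below and those that it enters bound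
    it from above; these bounds are compatible because the surplus is
    submodular, with a gain of [h a - l a] when the two cuts separate the
    endpoints of [a] in opposite directions ([cut_surplus_uncross]).  Once all
    edges are pinned, the cut conditions for a vertex and for its complement are
    opposite inequalities, which gives conservation at this vertex. *)

(** * Hoffman's circulation theorem *)

Section Hoffman.

Variables (R : realDomainType) (V E : finType) (src tgt : E -> V).
Implicit Types (l h f : E -> R) (S X Y : {set V}).

Definition leaving S e := (src e \in S) && (tgt e \notin S).
Definition entering S e := (src e \notin S) && (tgt e \in S).

Definition circulation l h f :=
  (forall e, l e <= f e <= h e) /\
  (forall v, \sum_(e | src e == v) f e = \sum_(e | tgt e == v) f e).

Definition cut_surplus l h S :=
  \sum_(e | leaving S e) h e - \sum_(e | entering S e) l e.

Lemma cut_surplusE l h S :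
  cut_surplus l h S =
  \sum_e ((if leaving S e then h e else 0) -
          (if entering S e then l e else 0)).
Proof. by rewrite sumrB -!big_mkcond. Qed.

(** Edges with both ends in [S] cancel when the excesses of the vertices of [S]
    are added.  The two uses are opposite: conservation gives surplus zero, and
    singletons [S] recover conservation from the surplus. *)
Lemma cut_surplus_excess f S :
  cut_surplus f f S =
  \sum_(v in S) (\sum_(e | src e == v) f e - \sum_(e | tgt e == v) f e).
Proof.
have fiber (k : E -> V) :
    \sum_(v in S) \sum_(e | k e == v) f e = \sum_(e | k e \in S) f e.
  rewrite [RHS](partition_big k (mem S)) //=; apply: eq_bigr => v vS.
  by apply: eq_bigl => e; case: eqP => [->|]; rewrite ?vS ?andbF.
rewrite sumrB !fiber cut_surplusE !(big_mkcond (fun e => _ \in S)) -sumrB.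
apply: eq_bigr => e _; rewrite /leaving /entering.
by case: (src e \in S); case: (tgt e \in S); rewrite /= ?subrr.
Qed.

Lemma cut_surplus_setC f S : cut_surplus f f (~: S) = - cut_surplus f f S.
Proof.
rewrite /cut_surplus opprB; congr (_ - _); apply: eq_bigl => e;
  by rewrite /leaving /entering !inE ?negbK.
Qed.

(** Submodularity, edge by edge: an edge [e] contributes equally to both
    sides, unless it joins [X :\: Y] and [Y :\: X] (in either direction), in
    which case it adds [h e - l e] to the right-hand side only.  The edge [a] is
    of the latter kind. *)
Lemma cut_surplus_uncross l h X Y a :
    (forall e, l e <= h e) -> leaving X a -> entering Y a ->
  cut_surplus l h (X :&: Y) + cut_surplus l h (X :|: Y) + (h a - l a)
    <= cut_surplus l h X + cut_surplus l h Y.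
Proof.
move=> le_lh Xa Ya; rewrite !cut_surplusE -!big_split /=.
rewrite (bigD1 a) //= [leRHS](bigD1 a) //= [leLHS]addrAC lerD //.
  move: Xa Ya; rewrite /leaving /entering !inE.
  by do 4![case: (_ \in _)] => //= _ _; lra.
apply: ler_sum => e _; move: (le_lh e); rewrite /leaving /entering !inE.
by do 4![case: (_ \in _)] => /=; lra.
Qed.

Definition pin f a x : E -> R := [eta f with a |-> x].

(** The surplus of a cut sees only the upper bound of an edge that leaves it and
    only the lower bound of an edge that enters it. *)
Lemma cut_surplus_pin l h a x S :
  cut_surplus (pin l a x) (pin h a x) S =
  cut_surplus l h S + (if leaving S a then x - h a else 0)
                    - (if entering S a then x - l a else 0).
Proof.
rewrite !cut_surplusE (bigD1 a) //= [in RHS](bigD1 a) //= /pin /= eqxx.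
under eq_bigr => e /negPf ne do rewrite ne.
by case: ifP => _; case: ifP => _; lra.
Qed.

(** The value chosen for [a] is the least one compatible with the old lower
    bound and with all the cuts that [a] leaves; uncrossing shows that the cuts
    that [a] enters tolerate it. *)
Lemma pin_feasible l h a :
    (forall e, l e <= h e) -> (forall S, 0 <= cut_surplus l h S) ->
  exists2 x, l a <= x <= h a &
    forall S, 0 <= cut_surplus (pin l a x) (pin h a x) S.
Proof.
move=> le_lh ge0.
pose x := \big[Num.max/l a]_(X | leaving X a) (h a - cut_surplus l h X).
have ge_l : l a <= x by apply: bigmax_ge_id.
exists x.
  rewrite ge_l; apply/bigmax_leP; split=> // X _.
  by rewrite lerBlDr lerDl.
move=> S; rewrite cut_surplus_pin; case: ifP => [outS|_].
  have -> : entering S a = false.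
    by move: outS; rewrite /leaving /entering => /andP[->].
  have : h a - cut_surplus l h S <= x by exact: le_bigmax_cond.
  lra.
case: ifP => [inS|_]; last by rewrite addr0 subr0.
suff : x <= cut_surplus l h S + l a by lra.
apply/bigmax_leP; split=> [|X outX]; first by rewrite lerDr.
have := cut_surplus_uncross le_lh outX inS.
have := ge0 (X :&: S); have := ge0 (X :|: S); lra.
Qed.

Theorem hoffman_circulation l h : (forall e, l e <= h e) ->
  (exists f, circulation l h f) <->
  (forall S, \sum_(e | entering S e) l e <= \sum_(e | leaving S e) h e).
Proof.
move=> le_lh; split=> [[f [bnd cons]] S | cut].
  apply: (@le_trans _ _ (\sum_(e | entering S e) f e)).
    by apply: ler_sum => e _; case/andP: (bnd e).
  apply: (@le_trans _ _ (\sum_(e | leaving S e) f e)); last first.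
    by apply: ler_sum => e _; case/andP: (bnd e).
  rewrite -subr_ge0 -/(cut_surplus f f S) cut_surplus_excess.
  by rewrite big1 // => v _; rewrite cons subrr.
have {cut} ge0 S : 0 <= cut_surplus l h S by rewrite subr_ge0.
(* Induction on the number of edges whose bounds still differ. *)
have [n] := ubnP #|[pred e | l e != h e]|.
elim: n l h le_lh ge0 => // n IHn l h le_lh ge0 le_n.
have [/existsP[a ne_a] | /existsPn eq_lh] := boolP [exists e, l e != h e].
  have [x /andP[le_lx le_xh] ge0x] := pin_feasible a le_lh ge0.
  have [e|//||f [bnd cons]] := IHn (pin l a x) (pin h a x).
  - by rewrite /pin /=; case: eqP.
  - rewrite -ltnS (leq_trans _ le_n) // ltnS; apply: proper_card.
    apply/properP; split; last by exists a; rewrite !inE /pin /= ?eqxx.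
    apply/fintype.subsetP => e; rewrite !inE /pin /=.
    by case: (e == a); rewrite ?eqxx.
  exists f; split=> // e; move: (bnd e); rewrite /pin /=.
  case: eqP => [->|_ //] /andP[le_xf le_fx].
  by rewrite (le_trans le_lx) // (le_trans le_fx).
(* All edges are pinned: [l] itself is the circulation. *)
have surplus_l S : cut_surplus l h S = cut_surplus l l S.
  by congr (_ - _); apply: eq_bigr => e _; apply/esym/eqP/negPn.
exists l; split=> [e|v]; first by rewrite lexx le_lh.
apply/eqP; rewrite -subr_eq0.
pose excess w := \sum_(e | src e == w) l e - \sum_(e | tgt e == w) l e.
rewrite -/(excess v) -(big_set1 (+%R : Monoid.law 0) v excess).
rewrite -cut_surplus_excess eq_le -oppr_ge0 -cut_surplus_setC.
by rewrite -!surplus_l !ge0.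
Qed.

End Hoffman.

(** * The charging network *)

Section Network.

Variables (R : realType) (m N : nat) (Omega : 'I_N -> load R m).

Notation node := (option ('I_N + 'I_m)).
Notation edge := ('I_N + 'I_N * 'I_m + 'I_m)%type.

(** [None] is the hub.  Joining every load to every slot keeps the edges a plain
    product; outside the charging window the edge has capacity zero. *)
Definition edge_src (e : edge) : node :=
  match e with
  | inl (inl _) => None
  | inl (inr it) => Some (inl it.1)
  | inr t => Some (inr t)
  end.

Definition edge_tgt (e : edge) : node :=
  match e with
  | inl (inl i) => Some (inl i)
  | inl (inr it) => Some (inr it.2)
  | inr _ => None
  end.

Definition edge_lower (u : 'cV[R]_m) (e : edge) : R :=
  match e with
  | inl (inl i) => Emin (Omega i)
  | inl (inr _) => 0
  | inr t => u t ord0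
  end.

Definition edge_upper (u : 'cV[R]_m) (e : edge) : R :=
  match e with
  | inl (inl i) => Emax (Omega i)
  | inl (inr it) => if it.2 \in slots (Omega it.1) then rate (Omega it.1) else 0
  | inr t => u t ord0
  end.

Lemma sum_edges (P : pred edge) (F : edge -> R) :
  \sum_(e | P e) F e =
  \sum_(i | P (inl (inl i))) F (inl (inl i)) +
  \sum_i \sum_(t | P (inl (inr (i, t)))) F (inl (inr (i, t))) +
  \sum_(t | P (inr t)) F (inr t).
Proof.
rewrite !big_sumType /=; congr (_ + _ + _).
by rewrite pair_big_dep /=; apply: eq_big => [[i t]|[i t]].
Qed.

Lemma edge_conservationP (f : edge -> R) :
  (forall v, \sum_(e | edge_src e == v) f e = \sum_(e | edge_tgt e == v) f e)
  <->
  [/\ \sum_i f (inl (inl i)) = \sum_t f (inr t),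
      forall i, \sum_t f (inl (inr (i, t))) = f (inl (inl i))
    & forall t, f (inr t) = \sum_i f (inl (inr (i, t)))].
Proof.
have drop0 (I : finType) (F : I -> R) : \sum_(i | false) F i = 0.
  by rewrite big_pred0.
have pick (I : finType) (i : I) (F : I -> R) : \sum_(j | j == i) F j = F i.
  by rewrite big_pred1_eq.
have hub : \sum_(e | edge_src e == None) f e = \sum_i f (inl (inl i)) /\
           \sum_(e | edge_tgt e == None) f e = \sum_t f (inr t).
  rewrite !sum_edges /=; split.
    by rewrite drop0 [X in _ + X + _]big1 ?addr0 // => i _; rewrite drop0.
  by rewrite drop0 [X in _ + X + _]big1 ?add0r // => i _; rewrite drop0.
have atload i :
    \sum_(e | edge_src e == Some (inl i)) f e = \sum_t f (inl (inr (i, t))) /\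
    \sum_(e | edge_tgt e == Some (inl i)) f e = f (inl (inl i)).
  rewrite !sum_edges /=; split.
    rewrite !drop0 add0r addr0 (bigD1 i) //= [X in _ + X]big1 ?addr0.
      by apply: eq_bigl => t; rewrite eqxx.
    by move=> j /negPf ji; apply: big_pred0 => t; apply/eqP => -[] /eqP;
      rewrite ji.
  rewrite drop0 [X in _ + X + _]big1 ?addr0 => [|j _]; last by rewrite drop0.
  by rewrite -[RHS](pick _ i (fun j => f (inl (inl j)))).
have atslot t :
    \sum_(e | edge_src e == Some (inr t)) f e = f (inr t) /\
    \sum_(e | edge_tgt e == Some (inr t)) f e = \sum_i f (inl (inr (i, t))).
  rewrite !sum_edges /=; split.
    rewrite drop0 [X in _ + X + _]big1 ?add0r => [|j _]; last by rewrite drop0.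
    by rewrite -[RHS](pick _ t (fun j => f (inr j))).
  rewrite !drop0 add0r addr0; apply: eq_bigr => i _.
  by rewrite -[RHS](pick _ t (fun j => f (inl (inr (i, j))))).
split=> [cons|[eq_hub eq_load eq_slot] [[i|t]|]].
- split=> [|i|t]; first by rewrite -hub.1 -hub.2.
    by rewrite -(atload i).1 -(atload i).2.
  by rewrite -(atslot t).1 -(atslot t).2.
- by rewrite (atload i).1 (atload i).2.
- by rewrite (atslot t).1 (atslot t).2.
- by rewrite hub.1 hub.2.
Qed.

Lemma adequate_circulation (u : 'cV[R]_m) :
  adequate Omega u <->
  exists f, circulation edge_src edge_tgt (edge_lower u) (edge_upper u) f.
Proof.
split=> [[v adm ->]|[f [bnd /edge_conservationP[_ eq_load eq_slot]]]].
  have slotE t : (\sum_i v i) t ord0 = \sum_i v i t ord0 by rewrite summxE.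
  exists (fun e => match e with
    | inl (inl i) => \sum_t v i t ord0
    | inl (inr it) => v it.1 it.2 ord0
    | inr t => (\sum_i v i) t ord0
    end); split=> [[[i|[i t]]|t] /=|].
  - by have [] := adm i.
  - have [in_slot out_slot _] := adm i.
    by case: ifPn => [/in_slot|/out_slot->]; rewrite ?lexx.
  - by rewrite lexx.
  apply/edge_conservationP; split=> //=.
  by rewrite exchange_big; apply: eq_bigr => t _; rewrite slotE.
exists (fun i => \col_t f (inl (inr (i, t)))) => [i|]; last first.
  apply/matrixP => t k; rewrite ord1 summxE.
  under eq_bigr => i _ do rewrite mxE.
  rewrite -eq_slot; apply/eqP; rewrite eq_le.
  by have /= := bnd (inr t); rewrite andbC.
split=> [t in_slot|t out_slot|].
- by rewrite mxE; have /= := bnd (inl (inr (i, t))); rewrite in_slot.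
- rewrite mxE; have /= := bnd (inl (inr (i, t))); rewrite (negPf out_slot).
  by move=> ?; apply/eqP; rewrite eq_le andbC.
- under eq_bigr => t _ do rewrite mxE.
  by rewrite eq_load; have := bnd (inl (inl i)).
Qed.

(** The complements are taken so that the load-to-slot edges leaving the cut run
    from [~: alpha] to [beta], the pairs whose capacities bound the energy that
    rates allow to flow there. *)
Definition cut_side (hub : bool) (alpha : {set 'I_N}) (beta : {set 'I_m}) :
    {set node} :=
  [set x | match x with
           | None => hub
           | Some (inl i) => i \in ~: alpha
           | Some (inr t) => t \in ~: beta
           end]%SET.

Lemma cut_sideP (S : {set node}) :
  exists hub alpha beta, S = cut_side hub alpha beta.
Proof.
exists (None \in S), [set i | Some (inl i) \notin S]%SET,
  [set t | Some (inr t) \notin S]%SET.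
by apply/setP => -[[i|t]|]; rewrite !inE ?negbK.
Qed.

Lemma cut_side_le (u : 'cV[R]_m) hub alpha beta :
  let S := cut_side hub alpha beta in
  (\sum_(e | entering edge_src edge_tgt S e) edge_lower u e
     <= \sum_(e | leaving edge_src edge_tgt S e) edge_upper u e) =
  (- (\sum_(i in ~: alpha) #|beta :&: slots (Omega i)|%:R * rate (Omega i)) <=
  if hub then \sum_(i in alpha) Emax (Omega i) - \sum_(t in beta) u t ord0
  else \sum_(t in ~: beta) u t ord0 - \sum_(i in ~: alpha) Emin (Omega i)).
Proof.
move=> S.
(* Load-to-slot edges leave the cut from loads outside [alpha] to slots in
   [beta]; only slots of the charging window have capacity. *)
have cap : \sum_i \sum_(t | leaving edge_src edge_tgt S (inl (inr (i, t))))
    edge_upper u (inl (inr (i, t))) =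
  \sum_(i in ~: alpha) #|beta :&: slots (Omega i)|%:R * rate (Omega i).
  rewrite [RHS]big_mkcond; apply: eq_bigr => i _.
  rewrite /leaving /= !inE; case: ifP => ia /=; last by rewrite big_pred0.
  rewrite -big_mkcondr mulr_natl -sumr_const.
  by apply: eq_bigl => t; rewrite !inE negbK.
have low : \sum_i \sum_(t | entering edge_src edge_tgt S (inl (inr (i, t))))
    edge_lower u (inl (inr (i, t))) = 0.
  by rewrite big1 // => i _; rewrite big1.
rewrite !sum_edges cap low addr0 /leaving /entering /= !inE.
set C := \sum_(i in ~: _) _ * _.
have loadS i : (Some (inl i) \in S) = (i \in ~: alpha) by rewrite inE.
have slotS t : (Some (inr t) \in S) = (t \in ~: beta) by rewrite inE.
case: hub @S cap low loadS slotS => S _ _ loadS slotS /=.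
  have -> : \sum_(t | (Some (inr t) \notin S) && true) u t ord0 =
      \sum_(t in beta) u t ord0.
    by apply: eq_bigl => t; rewrite slotS inE negbK andbT.
  have -> : \sum_(i | Some (inl i) \notin S) Emax (Omega i) =
      \sum_(i in alpha) Emax (Omega i).
    by apply: eq_bigl => i; rewrite loadS inE negbK.
  under [X in _ <= _ + X]eq_bigl => t do rewrite andbF.
  rewrite !big_pred0_eq add0r addr0.
  by rewrite lerNl opprB lerBlDr addrC.
have -> : \sum_(t | (Some (inr t) \in S) && true) u t ord0 =
    \sum_(t in ~: beta) u t ord0.
  by apply: eq_bigl => t; rewrite slotS andbT.
have -> : \sum_(i | Some (inl i) \in S) Emin (Omega i) =
    \sum_(i in ~: alpha) Emin (Omega i).
  by apply: eq_bigl => i; rewrite loadS.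
under [X in _ + X <= _]eq_bigl => t do rewrite andbF.
rewrite !big_pred0_eq add0r addr0.
by rewrite lerNl opprB lerBlDr.
Qed.

End Network.

Theorem theorem1 (R : realType) (m N : nat) (m_ge1 : (1 <= m)%N)
    (N_ge1 : (1 <= N)%N) (Omega : 'I_N -> load R m)
    (lt_ad : forall i, (arrival (Omega i) < departure (Omega i))%N)
    (rate_gt0 : forall i, 0 < rate (Omega i))
    (lt_E : forall i, Emin (Omega i) < Emax (Omega i)) :
  adequate Omega =
  [set u : 'cV[R]_m |
    forall (alpha : {set 'I_N}) (beta : {set 'I_m}),
      Num.min
        (\sum_(i in alpha) Emax (Omega i) - \sum_(t in beta) u t ord0)
        (\sum_(t in ~: beta) u t ord0 - \sum_(i in ~: alpha) Emin (Omega i))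
      >= - \sum_(i in ~: alpha)
             #|beta :&: slots (Omega i)|%:R * rate (Omega i)].
Proof.
have le_bounds u e : edge_lower Omega u e <= edge_upper Omega u e.
  case: e => [[i|[i t]]|t] //=; first exact: ltW.
  by case: ifP => // _; apply: ltW.
apply/seteqP; split=> u.
  move=> /adequate_circulation/(hoffman_circulation _ _ (le_bounds u)) cut.
  move=> alpha beta; rewrite le_min.
  have := cut (cut_side true alpha beta); rewrite cut_side_le => ->.
  by have := cut (cut_side false alpha beta); rewrite cut_side_le.
move=> bound; apply/adequate_circulation.
apply/(hoffman_circulation _ _ (le_bounds u)) => S.
have [hub [alpha [beta ->]]] := cut_sideP S; rewrite cut_side_le.
by have := bound alpha beta; rewrite le_min => /andP[]; case: hub.
Qed.
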